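(* Let $n\ge 2$, let $F=F_n$ be the free group on generators $g_1,\dots,g_n$, let $F^{(1)}=[F,F]$ be its derived subgroup and $F^{(2)}=[F^{(1)},F^{(1)}]$. Let $K$ be an algebraically closed field of characteristic $0$. If $w\in F^{(1)}\setminus F^{(2)}$, then the word map $w:\mathrm{PSL}(2,K)^n\to \mathrm{PSL}(2,K)$ is surjective.
   Context: For a group $H$ and a reduced word $w=\prod_{i=1}^k g_{n_i}^{m_i}\in F_n$, the word map $w:H^n\to H$ is $(x_1,\dots,x_n)\mapsto \prod_{i=1}^k x_{n_i}^{m_i}$ (noncommutative product in the given order). *)

(* Defs.v *)
From HB Require Import structures.
From mathcomp Require Import all_boot all_order all_algebra.
Set Implicit Arguments. Unset Strict Implicit. Unset Printing Implicit Defensive.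
Import Order.TTheory GRing.Theory Num.Theory.

(* Free group F_n on generators g_0, ..., g_(n-1), as freely reduced words.
   A letter (i, false) stands for g_i, (i, true) for g_i^-1. *)
Definition letter (n : nat) := ('I_n * bool)%type.
Definition fword (n : nat) := seq (letter n).

Definition linv n (a : letter n) : letter n := (a.1, ~~ a.2).

Definition cons_red n (a : letter n) (w : fword n) : fword n :=
  if w is b :: w' then (if b == linv a then w' else a :: w) else [:: a].

Definition red n (w : fword n) : fword n := foldr (@cons_red n) [::] w.

Definition fmul n (u v : fword n) : fword n := red (u ++ v).
Definition finv n (u : fword n) : fword n := rev (map (@linv n) u).
Definition fcomm n (u v : fword n) : fword n :=
  fmul (fmul (finv u) (finv v)) (fmul u v).

Fixpoint reduced n (w : fword n) : bool :=
  match w with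
  | a :: ((b :: _) as w') => (b != linv a) && reduced w'
  | _ => true
  end.

Inductive derived n (S : fword n -> Prop) : fword n -> Prop :=
| der_one : derived S [::]
| der_comm u v : S u -> S v -> derived S (fcomm u v)
| der_mul u v : derived S u -> derived S v -> derived S (fmul u v)
| der_inv u : derived S u -> derived S (finv u).

Definition F1 n : fword n -> Prop := derived (fun _ => True).
Definition F2 n : fword n -> Prop := derived (@F1 n).

Definition word_map (K : fieldType) n (w : fword n) (x : 'I_n -> 'M[K]_2)
  : 'M[K]_2 :=
  (\prod_(a <- w) (if a.2 then (x a.1)^-1 else x a.1))%R.

Local Open Scope ring_scope.
Definition SL2 (K : fieldType) (A : 'M[K]_2) : Prop := \det A = 1.

(* Main.v *)
From Pilot Require Import Defs.
From mathcomp Require Import all_boot all_order all_algebra.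
From mathcomp Require Import zify ring.
From Stdlib Require Import Classical.
Import GRing.Theory.

(* mathcomp.fingraph also exports a constant named finv. *)
Import Pilot.Defs.

(* Two non-scalar 2x2 matrices with equal trace and determinant are conjugate, so
   it is enough to realise every trace, and one non-trivial unipotent element.

   Traces: attach distinct lines of the plane to the 2n letters and let a generator
   act as z on its own line and as z^-1 on the line of its inverse.  For a
   cyclically reduced word of length L > 0 the trace is a Laurent polynomial in z
   whose coefficients at z^L and z^-L are non-zero, hence it takes every value on
   non-zero z.

   Unipotents: on upper triangular matrices a word w in F^(1) is unipotent, and its
   off-diagonal entry records, for every edge of the Cayley graph of Z^n, the signed
   number of times that the path of w crosses it, each edge being weighted by a
   character of the diagonal torus.  If the entry vanishes identically, independence
   of characters makes all these numbers zero.  Closing the edges along a section of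
   F -> Z^n writes w as a product of elements of F^(1), one for each edge crossed;
   in F^(1)/F^(2) they cancel, so that w lies in F^(2). *)

Set Implicit Arguments.
Unset Strict Implicit.
Unset Printing Implicit Defensive.

Section FreeReduction.

Variable n : nat.
Implicit Types (a b : letter n) (u v w : fword n).

Lemma linvK : involutive (@linv n).
Proof. by case=> i b; rewrite /linv /= negbK. Qed.

Lemma linv_inj : injective (@linv n).
Proof. exact/can_inj/linvK. Qed.

Lemma linv_neq a : linv a != a.
Proof. by case: a => i []; rewrite xpair_eqE andbF. Qed.

Lemma reducedE w : reduced w = sorted (fun a b => b != linv a) w.
Proof. by case: w => //= a w; elim: w a => //= b w IH a; rewrite IH. Qed.

Lemma reduced_map_linv w : reduced (map (@linv n) w) = reduced w.
Proof.
rewrite !reducedE sorted_map; apply: eq_sorted => a b /=.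
by rewrite (inj_eq linv_inj).
Qed.

Lemma red_id w : reduced w -> red w = w.
Proof.
elim: w => [|a [|b w] IH] // /andP[neq_ba red_w].
by rewrite -[LHS]/(cons_red a (red (b :: w))) IH //= (negbTE neq_ba).
Qed.

Lemma reduced_cons_red a w : reduced w -> reduced (cons_red a w).
Proof.
case: w => [|b w] //= red_w; case: eqP => [_|/eqP neq_ba] /=.
  by case: w red_w => [|c w] //= /andP[].
by rewrite neq_ba.
Qed.

Lemma reduced_red w : reduced (red w).
Proof. by elim: w => //= a w; apply: reduced_cons_red. Qed.

Lemma cons_redK a w : reduced w -> cons_red (linv a) (cons_red a w) = w.
Proof.
case: w => [|b w] /=; first by rewrite linvK eqxx.
case: eqP => [->|_] /=; last by rewrite linvK eqxx.
by case: w => [|c w] //= /andP[/negbTE->].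
Qed.

Lemma cons_red_linvK a w : reduced w -> cons_red a (cons_red (linv a) w) = w.
Proof. by rewrite -{1}[a]linvK; apply: cons_redK. Qed.

Lemma red_cat u v : red (u ++ v) = foldr (@cons_red n) (red v) u.
Proof. exact: foldr_cat. Qed.

Lemma red_catr u v : red (u ++ red v) = red (u ++ v).
Proof. by rewrite !red_cat red_id // reduced_red. Qed.

Lemma red_catl u v : red (red u ++ v) = red (u ++ v).
Proof.
elim: u => //= a u <-; case: (red u) => [|b u'] //=.
by case: eqP => // ->; rewrite cons_red_linvK // reduced_red.
Qed.

Lemma fmul_red u v : fmul (red u) (red v) = red (u ++ v).
Proof. by rewrite /fmul red_catl red_catr. Qed.

Lemma finvK : involutive (@finv n).
Proof. by move=> u; rewrite /finv map_rev revK mapK //; apply: linvK. Qed.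

Lemma finv_cat u v : finv (u ++ v) = finv v ++ finv u.
Proof. by rewrite /finv map_cat rev_cat. Qed.

Lemma red_cancel u v w : red (u ++ v ++ finv v ++ w) = red (u ++ w).
Proof.
rewrite red_cat [RHS]red_cat; congr foldr.
elim/last_ind: v w => // v a IH w.
rewrite -cats1 finv_cat /= -catA /= -[RHS](IH w).
rewrite red_cat [RHS]red_cat; congr foldr => /=.
by rewrite cons_red_linvK // reduced_red.
Qed.

Lemma red_cancelV u v w : red (u ++ finv v ++ v ++ w) = red (u ++ w).
Proof. by rewrite -{2}[v]finvK red_cancel. Qed.

Lemma reduced_finv u : reduced u -> reduced (finv u).
Proof.
rewrite !reducedE /finv rev_sorted sorted_map; congr (is_true _).
by apply: eq_sorted => a b /=; rewrite linvK eq_sym.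
Qed.

Lemma finv_red u : finv (red u) = red (finv u).
Proof.
rewrite -[LHS]red_id; last exact/reduced_finv/reduced_red.
rewrite -[in RHS](cats0 (finv u)) -(red_cancel _ (red u)) catA -[in RHS]red_catl.
by rewrite red_catr red_catl -catA (red_cancelV [::]) cats0.
Qed.

Lemma red_conj_cat (c p q : fword n) :
  red (c ++ p ++ finv c ++ q) =
  fmul (fcomm (finv (red c)) (finv (red p))) (red (p ++ q)).
Proof.
rewrite /fcomm !finvK !finv_red !fmul_red -!catA.
by rewrite [in RHS](catA c p) [in RHS](catA (c ++ p)) red_cancelV -!catA.
Qed.

End FreeReduction.

Section SubgroupPredicates.

Variable n : nat.

Definition fsubgroup (S : fword n -> Prop) : Prop :=
  [/\ S [::], forall u v, S u -> S v -> S (fmul u v) &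
      forall u, S u -> S (finv u)].

Lemma fsubgroup_derived (S : fword n -> Prop) : fsubgroup (derived S).
Proof. by split; [apply: der_one|apply: der_mul|apply: der_inv]. Qed.

End SubgroupPredicates.

Section SignedProducts.

Variables (n : nat) (E : eqType) (C : E -> fword n).

Definition signed_word (t : E * bool) : fword n :=
  if t.2 then finv (C t.1) else C t.1.

Definition signed_prod (L : seq (E * bool)) : fword n :=
  flatten (map signed_word L).

Definition balanced (L : seq (E * bool)) : Prop :=
  forall e, count_mem (e, false) L = count_mem (e, true) L.

Lemma signed_wordN e b : signed_word (e, ~~ b) = finv (signed_word (e, b)).
Proof. by case: b; rewrite /signed_word //= finvK. Qed.

Lemma signed_prod_cons t L :
  signed_prod (t :: L) = signed_word t ++ signed_prod L.
Proof. by []. Qed.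

Lemma signed_prod_cat L1 L2 :
  signed_prod (L1 ++ L2) = signed_prod L1 ++ signed_prod L2.
Proof. by rewrite /signed_prod map_cat flatten_cat. Qed.

Lemma red_signed_prod_opposite e b L1 L2 :
  red (signed_prod ((e, b) :: L1 ++ (e, ~~ b) :: L2)) =
  fmul (fcomm (finv (red (signed_word (e, b)))) (finv (red (signed_prod L1))))
       (red (signed_prod (L1 ++ L2))).
Proof.
rewrite signed_prod_cons !signed_prod_cat signed_prod_cons signed_wordN.
exact: red_conj_cat.
Qed.

Lemma balanced_remove e b L1 L2 :
  balanced ((e, b) :: L1 ++ (e, ~~ b) :: L2) -> balanced (L1 ++ L2).
Proof.
case: b => bal f; have := bal f; rewrite /= !count_cat /= !xpair_eqE;
  by case: (e == f) => /=; lia.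
Qed.

Lemma balanced_opposite e b L : balanced ((e, b) :: L) -> (e, ~~ b) \in L.
Proof.
move=> /(_ e); rewrite -has_pred1 has_count /= !xpair_eqE eqxx /=.
by case: b => /=; lia.
Qed.

Section SignedProductsInSubgroup.

Variables (S : fword n -> Prop) (subS : fsubgroup S).

Lemma fsubgroup_signed_word t : S (red (C t.1)) -> S (red (signed_word t)).
Proof.
have [_ _ SV] := subS.
by rewrite /signed_word; case: t.2 => // /SV; rewrite finv_red.
Qed.

Lemma fsubgroup_signed_prod L :
  (forall t, t \in L -> S (red (C t.1))) -> S (red (signed_prod L)).
Proof.
have [S1 SM _] := subS; elim: L => // t L IH SL.
rewrite signed_prod_cons -fmul_red; apply: SM.
  exact/fsubgroup_signed_word/SL/mem_head.
by apply: IH => t' t'L; apply: SL; rewrite inE t'L orbT.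
Qed.

(* Opposite factors are removed in pairs: c P c^-1 Q = [c^-1, P^-1] (P Q). *)
Lemma derived_balanced L :
    (forall t, t \in L -> S (red (C t.1))) -> balanced L ->
  derived S (red (signed_prod L)).
Proof.
have [_ _ SV] := subS.
have [m] := ubnP (size L); elim: m L => // m IH [|[e b] L] sz_L SL bal.
  exact: der_one.
have opp := balanced_opposite bal.
case/splitPr: L / opp sz_L SL bal => L1 L2 sz_L SL bal.
have SL1 t : t \in L1 -> S (red (C t.1)).
  by move=> tL1; apply: SL; rewrite inE mem_cat tL1 orbT.
have SL2 t : t \in L2 -> S (red (C t.1)).
  by move=> tL2; apply: SL; rewrite inE mem_cat inE tL2 !orbT.
rewrite red_signed_prod_opposite; apply: der_mul.
  apply: der_comm; apply: SV; last exact: fsubgroup_signed_prod.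
  exact/fsubgroup_signed_word/SL/mem_head.
apply: IH; last exact: balanced_remove bal.
  by move: sz_L; rewrite /= !size_cat /=; lia.
by move=> t; rewrite mem_cat => /orP[/SL1|/SL2].
Qed.

End SignedProductsInSubgroup.

Lemma sum_signs (R : pzRingType) e (L : seq (E * bool)) :
  (\sum_(t <- L | t.1 == e) (-1) ^+ t.2 =
   (count_mem (e, false) L)%:R - (count_mem (e, true) L)%:R :> R)%R.
Proof.
elim: L => [|[f b] L IH]; first by rewrite big_nil subr0.
rewrite big_cons /= IH !xpair_eqE; case: eqP => // _ /=.
by case: b => /=; rewrite !natrD add0r; [rewrite opprD addrCA|rewrite addrA].
Qed.

End SignedProducts.

Notation lattice n := {ffun 'I_n -> int}.

Section Abelianization.

Local Open Scope ring_scope.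

Variable n : nat.
Implicit Types (a : letter n) (u w : fword n) (v : lattice n).

Definition unit_vec (i : 'I_n) : lattice n := [ffun j => (j == i)%:R].

Lemma eq_lattice_mulr2 v v' : (v *+ 2 == v' *+ 2) = (v == v').
Proof.
apply/eqP/eqP => [/ffunP eq_vv'|->//]; apply/ffunP => i.
by have := eq_vv' i; rewrite !ffunMnE => /Num.Theory.pmulrnI->.
Qed.

Definition abel_letter a : lattice n :=
  if a.2 then - unit_vec a.1 else unit_vec a.1.

Definition abel w : lattice n := \sum_(a <- w) abel_letter a.

Lemma abel_nil : abel [::] = 0.
Proof. exact: big_nil. Qed.

Lemma abel_cons a w : abel (a :: w) = abel_letter a + abel w.
Proof. exact: big_cons. Qed.

Lemma abel_cat u w : abel (u ++ w) = abel u + abel w.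
Proof. exact: big_cat. Qed.

Lemma abel_linv a : abel_letter (linv a) = - abel_letter a.
Proof. by case: a => i []; rewrite /abel_letter /= ?opprK. Qed.

Lemma abel_finv w : abel (finv w) = - abel w.
Proof.
rewrite /finv; elim: w => [|a w IH]; first by rewrite abel_nil oppr0.
rewrite /= rev_cons -cats1 abel_cat IH !abel_cons abel_nil addr0 abel_linv.
by rewrite opprD addrC.
Qed.

Lemma abel_red w : abel (red w) = abel w.
Proof.
elim: w => //= a w IH; rewrite abel_cons -IH.
case: (red w) => [|b w'] /=; first by rewrite abel_cons.
case: eqP => [->|_]; last by rewrite abel_cons.
by rewrite abel_cons abel_linv addrA subrr add0r.
Qed.

Lemma abel_derived (S : fword n -> Prop) w : derived S w -> abel w = 0.
Proof.
elim=> [|u v _ _|u v _ IHu _ IHv|u _ IHu].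
- exact: abel_nil.
- rewrite /fcomm /fmul abel_red abel_cat !abel_red !abel_cat !abel_finv.
  by rewrite -opprD addNr.
- by rewrite /fmul abel_red abel_cat IHu IHv addr0.
- by rewrite abel_finv IHu oppr0.
Qed.

Lemma abelE w i :
  abel w i = (count_mem (i, false) w)%:R - (count_mem (i, true) w)%:R.
Proof.
rewrite -sum_signs /abel sum_ffunE [RHS]big_mkcond /=; apply: eq_bigr => -[j b] _.
by rewrite /abel_letter /=; case: b; rewrite !ffunE eq_sym; case: eqP.
Qed.

Lemma signed_prod_letters w : signed_prod (fun i => [:: (i, false)]) w = w.
Proof. by elim: w => // -[i b] w IH; rewrite signed_prod_cons IH; case: b. Qed.

Lemma F1_red w : abel w = 0 -> F1 (red w).
Proof.
move=> abw; rewrite -(signed_prod_letters w); apply: derived_balanced => // i.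
have /ffunP/(_ i)/eqP := abw.
by rewrite abelE ffunE subr_eq0 !natz eqz_nat => /eqP.
Qed.

Definition lattice_word v : fword n :=
  flatten [seq nseq `|v i|%N (i, v i < 0) | i <- enum 'I_n].

Lemma lattice_word0 : lattice_word 0 = [::].
Proof.
by rewrite /lattice_word; elim: (enum _) => //= i s ->; rewrite ffunE.
Qed.

Lemma abel_lattice_word v : abel (lattice_word v) = v.
Proof.
apply/ffunP => j.
have -> : abel (lattice_word v) j = \sum_(i <- enum 'I_n) if i == j then v i else 0.
  rewrite /lattice_word; elim: (enum _) => [|i s IH] /=.
    by rewrite abel_nil big_nil ffunE.
  rewrite abel_cat ffunE IH big_cons; congr (_ + _).
  rewrite abelE !count_nseq /= !xpair_eqE; case: eqP => _ /=; last by lia.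
  by case: (v i) => k /=; lia.
by rewrite big_enum -big_mkcond big_pred1_eq.
Qed.

End Abelianization.

Section CayleyPaths.

Local Open Scope ring_scope.

Variable n : nat.
Implicit Types (a : letter n) (w : fword n) (v : lattice n).

(* An edge of the Cayley graph of Z^n is recorded by its initial vertex and its
   direction; its word is the loop that closes it up along lattice_word. *)
Definition edge_word (e : lattice n * 'I_n) : fword n :=
  lattice_word e.1 ++ [:: (e.2, false)] ++ finv (lattice_word (e.1 + unit_vec e.2)).

(* The sign a.2 tells that the edge is crossed backwards. *)
Definition crossed_edge v a : lattice n * 'I_n * bool :=
  (if a.2 then v - unit_vec a.1 else v, a.1, a.2).

Fixpoint path_edges v w : seq (lattice n * 'I_n * bool) :=
  if w is a :: w' then crossed_edge v a :: path_edges (v + abel_letter a) w'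
  else [::].

Lemma signed_word_crossed_edge v a :
  signed_word edge_word (crossed_edge v a) =
  lattice_word v ++ [:: a] ++ finv (lattice_word (v + abel_letter a)).
Proof.
case: a => i []; rewrite /signed_word /crossed_edge /edge_word /abel_letter //=.
by rewrite subrK finv_cat -cat1s finv_cat finvK /= -catA.
Qed.

Lemma red_lattice_word_cat v w :
  red (lattice_word v ++ w) =
  red (signed_prod edge_word (path_edges v w) ++ lattice_word (v + abel w)).
Proof.
elim: w v => [|a w IH] v; first by rewrite abel_nil addr0 cats0.
rewrite /= signed_prod_cons abel_cons addrA signed_word_crossed_edge.
rewrite -[in RHS]catA -[in RHS]red_catr -IH red_catr -!catA.
by rewrite [in RHS](catA _ [:: a]) red_cancelV -catA.
Qed.

Lemma F1_edge_word e : F1 (red (edge_word e)).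
Proof.
apply: F1_red; rewrite !abel_cat abel_finv !abel_lattice_word abel_cons abel_nil.
by rewrite addr0 addrA subrr.
Qed.

Lemma F2_balanced w :
  reduced w -> abel w = 0 -> balanced (path_edges 0 w) -> F2 w.
Proof.
move=> red_w abw bal; rewrite -(red_id red_w).
have := red_lattice_word_cat 0 w.
rewrite abw addr0 lattice_word0 cats0 /= => ->.
apply: derived_balanced bal; first exact: fsubgroup_derived.
by move=> t _; apply: F1_edge_word.
Qed.

End CayleyPaths.

Section CharacteristicZero.

Local Open Scope ring_scope.

Lemma pchar0_natr_inj (R : idomainType) :
  [pchar R] =i pred0 -> injective (fun m : nat => m%:R : R).
Proof.
move=> /pcharf0P nat0 m p.
wlog le_mp : m p / (m <= p)%N => [wl|/eqP].
  case/orP: (leq_total m p) => le eq_mp; first exact: wl.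
  exact/esym/wl.
rewrite eq_sym -subr_eq0 -natrB // nat0 subn_eq0 => le_pm.
by apply/eqP; rewrite eqn_leq le_mp.
Qed.

Lemma pchar0_exprz2_inj (K : fieldType) :
  [pchar K] =i pred0 -> injective (exprz (2 : K)).
Proof.
move=> pchar0; have /pcharf0P nat0 := pchar0.
have two_neq0 : 2 != 0 :> K by rewrite nat0.
have pow2_eq1 p : 2 ^+ p = 1 :> K -> p = 0%N.
  move=> pow1; have : (2 ^ p = 1)%N.
    by apply: (pchar0_natr_inj pchar0); rewrite natrX.
  by case: p {pow1} => // p; rewrite expnS; lia.
have exp2_eq1 k : 2 ^ k = 1 :> K -> k = 0.
  case: k => p; first by move/pow2_eq1->.
  by move/(congr1 GRing.inv); rewrite invr1 NegzE -exprnN invrK => /pow2_eq1.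
move=> k l eq_kl; apply/eqP; rewrite -subr_eq0; apply/eqP/exp2_eq1.
by rewrite expfzDr // eq_kl -invr_expz mulfV // expfz_neq0.
Qed.

End CharacteristicZero.

Section Characters.

Local Open Scope ring_scope.

(* Dedekind's argument: a relation evaluated at [g0 * g], minus [chi v0 g0] times
   the relation at [g], is a shorter relation. *)
Lemma characters_free (K : idomainType) (G : Type) (mul : G -> G -> G)
    (P : G -> Prop) (V : eqType) (chi : V -> G -> K) (s : seq V) (c : V -> K) :
    (forall g h, P g -> P h -> P (mul g h)) ->
    (forall v g h, P g -> P h -> chi v (mul g h) = chi v g * chi v h) ->
    (forall v, exists2 g, P g & chi v g != 0) ->
    (forall v v', v != v' -> exists2 g, P g & chi v g != chi v' g) ->
    uniq s -> (forall g, P g -> \sum_(v <- s) c v * chi v g = 0) ->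
  forall v, v \in s -> c v = 0.
Proof.
move=> PM chiM nz sep; elim: s c => // v0 s IH c /= /andP[v0s uniq_s] rel.
have c0 v : v \in s -> c v = 0.
  move=> vs; have /sep[g0 Pg0 sep_g0] : v != v0.
    by apply: contraNneq v0s => <-.
  suff /eqP : c v * (chi v g0 - chi v0 g0) = 0.
    by rewrite mulf_eq0 subr_eq0 (negbTE sep_g0) orbF => /eqP.
  apply: (IH (fun v => c v * (chi v g0 - chi v0 g0)) uniq_s) vs => g Pg /=.
  transitivity (\sum_(u <- v0 :: s) c u * chi u (mul g0 g) -
                chi v0 g0 * \sum_(u <- v0 :: s) c u * chi u g).
    rewrite mulr_sumr -sumrB big_cons chiM // mulrCA subrr add0r.
    by apply: eq_bigr => u _; rewrite chiM //; ring.
  by rewrite !rel ?mulr0 ?subr0 //; apply: PM.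
move=> v; rewrite inE => /orP[/eqP->|/c0//].
have [g Pg nzg] := nz v0; have := rel g Pg.
rewrite big_cons big_seq big1 ?addr0; last by move=> u /c0->; rewrite mul0r.
by move/eqP; rewrite mulf_eq0 (negbTE nzg) orbF => /eqP.
Qed.

Lemma big_undup_fiber (R : Type) (idx : R) (op : Monoid.com_law idx)
    (I J : eqType) (f : I -> J) (F : I -> R) (s : seq I) :
  \big[op/idx]_(i <- s) F i =
  \big[op/idx]_(j <- undup (map f s)) \big[op/idx]_(i <- s | f i == j) F i.
Proof.
rewrite (exchange_big_dep xpredT) //= big_seq [RHS]big_seq.
apply: eq_bigr => i i_s; rewrite -big_filter (eq_filter (eq_sym (f i))).
by rewrite filter_pred1_uniq ?undup_uniq ?mem_undup ?map_f // big_seq1.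
Qed.

End Characters.

Section TorusCharacters.

Local Open Scope ring_scope.

Variables (K : fieldType) (n : nat).
Implicit Types (lam : 'I_n -> K) (v : lattice n).

Definition nonvanishing lam : Prop := forall i, lam i != 0.

Definition torus_char v lam : K := \prod_i lam i ^ v i.

Lemma torus_charM v lam lam' :
  torus_char v (fun i => lam i * lam' i) = torus_char v lam * torus_char v lam'.
Proof. by rewrite -big_split; apply: eq_bigr => i _; rewrite expfzMl. Qed.

Lemma torus_char0 lam : torus_char 0 lam = 1.
Proof. by apply: big1 => i _; rewrite ffunE expr0z. Qed.

Lemma torus_charN v lam : torus_char (- v) lam = (torus_char v lam)^-1.
Proof.
rewrite -prodfV; apply: eq_bigr => i _.
by rewrite ffunE -invr_expz.
Qed.

Lemma torus_char_unit_vec i lam : torus_char (unit_vec i) lam = lam i.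
Proof.
rewrite /torus_char (bigD1 i) //= big1 => [|j /negbTE neq_ji]; rewrite ffunE.
  by rewrite eqxx expr1z mulr1.
by rewrite neq_ji expr0z.
Qed.

Lemma torus_charD v v' lam : nonvanishing lam ->
  torus_char (v + v') lam = torus_char v lam * torus_char v' lam.
Proof.
move=> nz; rewrite -big_split; apply: eq_bigr => i _.
by rewrite ffunE expfzDr.
Qed.

Lemma torus_char_neq0 v lam : nonvanishing lam -> torus_char v lam != 0.
Proof. by move=> nz; apply/prodf_neq0 => i _; apply: expfz_neq0. Qed.

Hypothesis pchar0 : [pchar K] =i pred0.

Lemma torus_char_separated v v' : v != v' ->
  exists2 lam, nonvanishing lam & torus_char v lam != torus_char v' lam.
Proof.
move=> neq_v; have [i neq_i] : exists i, v i != v' i.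
  apply/existsP; apply: contraNT neq_v => /existsPn eq_v.
  by apply/eqP/ffunP => i; apply/eqP; rewrite -[_ == _]negbK.
exists (fun j => if j == i then 2 else 1) => [j|].
  by case: ifP; rewrite ?oner_neq0 // (proj1 (pcharf0P K) pchar0).
have eval_at_two u : torus_char u (fun j => if j == i then 2 else 1) = 2 ^ u i.
  rewrite /torus_char (bigD1 i) //= eqxx big1 ?mulr1 // => j /negbTE->.
  by rewrite exp1rz.
by rewrite !eval_at_two (inj_eq (pchar0_exprz2_inj pchar0)).
Qed.

Lemma torus_char_free (T : eqType) (f : T -> lattice n) (c : T -> K) (L : seq T) :
    (forall lam, nonvanishing lam ->
       \sum_(t <- L) c t * torus_char (f t) lam = 0) ->
  forall v, \sum_(t <- L | f t == v) c t = 0.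
Proof.
move=> rel v; have [v_in|v_notin] := boolP (v \in undup (map f L)); last first.
  rewrite mem_undup in v_notin.
  elim: L v_notin {rel} => [|t L IH]; first by rewrite big_nil.
  by rewrite big_cons inE negb_or eq_sym => /andP[/negbTE-> /IH].
apply: (@characters_free K _ (fun lam lam' i => lam i * lam' i) nonvanishing
  _ torus_char _ (fun v => \sum_(t <- L | f t == v) c t)) (undup_uniq _) _ v v_in.
- by move=> g h Pg Ph i; rewrite mulf_neq0.
- by move=> u g h _ _; apply: torus_charM.
- move=> u; exists (fun=> 1) => [i|]; first exact: oner_neq0.
  by apply: torus_char_neq0 => i; apply: oner_neq0.
- exact: torus_char_separated.
move=> lam /rel; rewrite (big_undup_fiber _ f) => rel_lam; rewrite -[RHS]rel_lam.
apply: eq_bigr => u _; rewrite mulr_suml.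
by apply: eq_bigr => t /eqP->.
Qed.

End TorusCharacters.

Section SquareMatrices.

Local Open Scope ring_scope.

Lemma mulmx1_invr (R : comUnitRingType) m (A B : 'M[R]_m.+1) : A * B = 1 -> A^-1 = B.
Proof.
move=> AB; have /mulmx1_unit[uA _] : A *m B = 1%:M by [].
by rewrite -[RHS]mul1r -(mulVr uA) -mulrA AB mulr1.
Qed.

Lemma det_conjmx (K : fieldType) m (P A : 'M[K]_m) :
  P \in unitmx -> \det (conjmx P A) = \det A.
Proof.
move=> uP; rewrite conjumx // !det_mulmx mulrAC -det_mulmx mulmxV // det1.
by rewrite mul1r.
Qed.

Lemma is_scalar_mxN (V : zmodType) m (A : 'M[V]_m) :
  is_scalar_mx (- A) = is_scalar_mx A.
Proof.
by apply/is_scalar_mxP/is_scalar_mxP => -[c AE]; exists (- c);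
  rewrite raddfN /= -AE ?opprK.
Qed.

End SquareMatrices.

Section TwoByTwo.

Local Open Scope ring_scope.

Variable K : fieldType.
Implicit Types (A B P : 'M[K]_2) (p q z : K).

Definition mx2 (a b c d : K) : 'M[K]_2 :=
  \matrix_(i, j) if i == 0 then (if j == 0 then a else b)
                 else (if j == 0 then c else d).

Lemma mx2_eta A : A = mx2 (A 0 0) (A 0 1) (A 1 0) (A 1 1).
Proof.
by apply/matrixP => -[[|[|i]] Hi] // -[[|[|j]] Hj] //; rewrite mxE /=;
  congr (A _ _); apply: val_inj.
Qed.

Lemma mx2M a b c d a' b' c' d' :
  mx2 a b c d * mx2 a' b' c' d' =
  mx2 (a * a' + b * c') (a * b' + b * d') (c * a' + d * c') (c * b' + d * d').
Proof.
apply/matrixP => i j; rewrite [LHS]mxE !big_ord_recl big_ord0 !mxE /= addr0.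
by case: (i == 0); case: (j == 0).
Qed.

Lemma mx2_1 : 1 = mx2 1 0 0 1.
Proof. by rewrite [LHS]mx2_eta !mxE. Qed.

Lemma det_mx2 a b c d : \det (mx2 a b c d) = a * d - b * c.
Proof.
rewrite (expand_det_row _ 0) !big_ord_recl big_ord0 /cofactor !det_mx11 !mxE /=.
by rewrite /bump /= expr0 expr1; ring.
Qed.

Lemma mxtrace_mx2 a b c d : \tr (mx2 a b c d) = a + d.
Proof. by rewrite /mxtrace !big_ord_recl big_ord0 !mxE /= addr0. Qed.

Lemma mx2Z k a b c d : k *: mx2 a b c d = mx2 (k * a) (k * b) (k * c) (k * d).
Proof. by rewrite [LHS]mx2_eta !mxE. Qed.

Lemma mx2D a b c d a' b' c' d' :
  mx2 a b c d + mx2 a' b' c' d' = mx2 (a + a') (b + b') (c + c') (d + d').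
Proof. by rewrite [LHS]mx2_eta !mxE. Qed.

Lemma is_scalar_mx2 a b c d :
  is_scalar_mx (mx2 a b c d) = [&& b == 0, c == 0 & a == d].
Proof.
apply/is_scalar_mxP/and3P => [[e]|[/eqP-> /eqP-> /eqP->]]; last first.
  by exists d; rewrite [RHS]mx2_eta !mxE.
by rewrite [e%:M]mx2_eta !mxE /= mulr1n mulr0n => /matrixP eqM;
  move: (eqM 0 0) (eqM 0 1) (eqM 1 0) (eqM 1 1); rewrite !mxE /= => -> -> -> ->.
Qed.

(* The rows of P are v and v A, for a vector v = (p, q) that is not an
   eigenvector. *)
Lemma similar_companion A : ~~ is_scalar_mx A ->
  exists2 P, P \in unitmx & similar P A (mx2 0 1 (- \det A) (\tr A)).
Proof.
rewrite [A]mx2_eta; move: (A 0 0) (A 0 1) (A 1 0) (A 1 1) => a b c d.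
rewrite is_scalar_mx2 => nscal.
have [p [q nz]] : exists p q, p ^+ 2 * b + p * q * (d - a) - q ^+ 2 * c != 0.
  have [b0|b0] := eqVneq b 0; last first.
    by exists 1, 0; rewrite expr1n expr0n /= !mulr0 !mul0r mul1r addr0 subr0.
  have [c0|c0] := eqVneq c 0; last first.
    by exists 0, 1; rewrite expr1n expr0n /= !mul0r mul1r add0r sub0r oppr_eq0.
  exists 1, 1; rewrite b0 c0 !mulr0 !mul1r add0r subr0 subr_eq0 eq_sym.
  by move: nscal; rewrite b0 c0 eqxx.
have uP : mx2 p q (p * a + q * c) (p * b + q * d) \in unitmx.
  by rewrite unitmxE det_mx2 unitfE; apply: contra_neq nz => <-; ring.
exists (mx2 p q (p * a + q * c) (p * b + q * d)) => //; apply/similarP => //.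
by rewrite det_mx2 mxtrace_mx2 mulmxE !mx2M; congr mx2; ring.
Qed.

Lemma similar_of_trace_det A B :
    ~~ is_scalar_mx A -> ~~ is_scalar_mx B ->
    \tr A = \tr B -> \det A = \det B ->
  exists2 P, P \in unitmx & similar P A B.
Proof.
move=> /similar_companion[P uP /eqP simA] /similar_companion[Q uQ simB].
move=> eq_tr eq_det.
exists (invmx Q *m P); first by rewrite unitmx_mul unitmx_inv uQ.
apply/eqP; rewrite conjuMumx ?unitmx_inv // simA eq_tr eq_det.
by rewrite -(similarLR uQ simB).
Qed.

(* The column (1, p) times the row (- q, 1). *)
Definition rank1 p q : 'M[K]_2 := mx2 (- q) 1 (- (p * q)) p.

Lemma rank1M p q p' q' : rank1 p q * rank1 p' q' = (p' - q) *: rank1 p q'.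
Proof. by rewrite mx2M mx2Z; congr mx2; ring. Qed.

Lemma mxtrace_rank1 p q : \tr (rank1 p q) = p - q.
Proof. by rewrite mxtrace_mx2 addrC. Qed.

(* The projection onto the line of slope p along the line of slope q. *)
Definition line_proj p q : 'M[K]_2 := (p - q)^-1 *: rank1 p q.

Definition dilation z p q : 'M[K]_2 :=
  z *: line_proj p q + z^-1 *: line_proj q p.

Lemma dilation_mx2 z p q : z != 0 -> p != q ->
  dilation z p q =
  mx2 ((z^-1 * p - z * q) / (p - q)) ((z - z^-1) / (p - q))
      (p * q * (z^-1 - z) / (p - q)) ((z * p - z^-1 * q) / (p - q)).
Proof.
move=> nz; rewrite -subr_eq0 => neq_pq.
rewrite /dilation /line_proj /rank1 !mx2Z mx2D -[q - p]opprB.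
by congr mx2; field; rewrite ?oppr_eq0 neq_pq nz.
Qed.

Lemma det_dilation z p q : z != 0 -> p != q -> \det (dilation z p q) = 1.
Proof.
move=> nz neq_pq; rewrite dilation_mx2 // det_mx2.
by move: neq_pq; rewrite -subr_eq0 => neq_pq; field; rewrite neq_pq nz.
Qed.

Lemma dilationV z p q : z != 0 -> p != q -> (dilation z p q)^-1 = dilation z q p.
Proof.
move=> nz neq_pq; have neq_qp : q != p by rewrite eq_sym.
apply: mulmx1_invr; rewrite !dilation_mx2 // mx2M mx2_1 -[q - p]opprB.
move: neq_pq; rewrite -subr_eq0 => neq_pq.
by congr mx2; field; rewrite ?oppr_eq0 neq_pq nz.
Qed.

End TwoByTwo.

Section WordMaps.

Local Open Scope ring_scope.

Variables (K : fieldType) (n : nat).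
Implicit Types (a : letter n) (w : fword n) (x : 'I_n -> 'M[K]_2).
Implicit Types g h P : 'M[K]_2.

Lemma SL2_unit g : SL2 g -> g \is a GRing.unit.
Proof.
by rewrite /SL2 -[_ \is a _]/(_ \in unitmx) unitmxE => ->; apply: unitr1.
Qed.

Lemma SL2N g : SL2 g -> SL2 (- g).
Proof. by rewrite /SL2 -scaleN1r detZ sqrrN expr1n mul1r. Qed.

Lemma SL2_scalar g : SL2 g -> is_scalar_mx g -> g = 1 \/ g = -1.
Proof.
move=> SLg /is_scalar_mxP[c gE]; move: SLg; rewrite /SL2 gE det_scalar.
move/eqP; rewrite sqrf_eq1 => /orP[]/eqP->; first by left.
by right; rewrite raddfN.
Qed.

Lemma SL2_nonscalar g : SL2 g -> \tr g != 2 -> \tr g != -2 -> ~~ is_scalar_mx g.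
Proof.
move=> SLg tr_g tr_Ng; apply/negP => /(SL2_scalar SLg)[] gE.
  by rewrite gE mxtrace1 eqxx in tr_g.
by rewrite gE raddfN /= mxtrace1 eqxx in tr_Ng.
Qed.

Definition letter_map x a : 'M[K]_2 := if a.2 then (x a.1)^-1 else x a.1.

Lemma word_map_nil x : word_map [::] x = 1.
Proof. exact: big_nil. Qed.

Lemma word_map_cons a w x : word_map (a :: w) x = letter_map x a * word_map w x.
Proof. exact: big_cons. Qed.

Lemma word_map_rcons a w x :
  word_map (rcons w a) x = word_map w x * letter_map x a.
Proof. by rewrite /word_map -cats1 big_cat big_seq1. Qed.

Lemma letter_map_linv a x : (forall i, SL2 (x i)) ->
  letter_map x (linv a) * letter_map x a = 1.
Proof.
by move=> SLx; rewrite /letter_map; case: a => i [] /=;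
  rewrite ?mulrV ?mulVr ?SL2_unit.
Qed.

Lemma SL2_word_map w x : (forall i, SL2 (x i)) -> SL2 (word_map w x).
Proof.
move=> SLx; rewrite /SL2; elim: w => [|a w IH].
  by rewrite word_map_nil det1.
rewrite word_map_cons det_mulmx IH mulr1 /letter_map.
by case: a.2; rewrite ?det_inv SLx ?invr1.
Qed.

Lemma word_map1 w : word_map w (fun=> 1 : 'M[K]_2) = 1.
Proof. by apply: big1 => a _; rewrite invr1 if_same. Qed.

Lemma word_map_conjmx w x P : (forall i, SL2 (x i)) -> P \in unitmx ->
  word_map w (fun i => conjmx P (x i)) = conjmx P (word_map w x).
Proof.
move=> SLx uP; have conjM g h : conjmx P (g * h) = conjmx P g * conjmx P h.
  by rewrite conjmxM // inE stablemx_unit.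
have conj1 : conjmx P 1 = 1 by rewrite conjmx_scalar // row_free_unit.
have conjV g : SL2 g -> conjmx P g^-1 = (conjmx P g)^-1.
  by move=> /SL2_unit ug; apply/esym/mulmx1_invr; rewrite -conjM mulrV.
elim: w => [|a w IH]; first by rewrite !word_map_nil conj1.
by rewrite !word_map_cons conjM IH /letter_map; case: a.2; rewrite ?conjV.
Qed.

Definition word_image w g : Prop :=
  exists2 x, forall i, SL2 (x i) & word_map w x = g.

Lemma word_image1 w : word_image w 1.
Proof. by exists (fun=> 1); [move=> i; apply: det1 | apply: word_map1]. Qed.

Lemma SL2_word_image w g : word_image w g -> SL2 g.
Proof. by case=> x SLx <-; apply: SL2_word_map. Qed.

Lemma word_image_conjmx w g P :
  P \in unitmx -> word_image w g -> word_image w (conjmx P g).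
Proof.
move=> uP [x SLx <-]; exists (fun i => conjmx P (x i)) => [i|].
  by rewrite /SL2 det_conjmx //; apply: SLx.
exact: word_map_conjmx.
Qed.

Lemma word_image_eq_trace w g h :
    word_image w h -> ~~ is_scalar_mx h -> SL2 g -> ~~ is_scalar_mx g ->
  \tr g = \tr h -> word_image w g.
Proof.
move=> im_h nscal_h SLg nscal_g eq_tr.
have [] := similar_of_trace_det nscal_h nscal_g (esym eq_tr).
  by rewrite SLg (SL2_word_image im_h).
by move=> P uP /eqP <-; apply: word_image_conjmx.
Qed.

End WordMaps.

Section TriangularWords.

Local Open Scope ring_scope.

Variables (K : fieldType) (n : nat).
Implicit Types (lam mu : 'I_n -> K) (a : letter n) (w : fword n) (v : lattice n).
Implicit Types L : seq (lattice n * 'I_n * bool).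

Definition upper lam mu (i : 'I_n) : 'M[K]_2 :=
  mx2 (lam i) (mu i / lam i) 0 (lam i)^-1.

Lemma SL2_upper lam mu i : nonvanishing lam -> SL2 (upper lam mu i).
Proof. by move=> nz; rewrite /SL2 det_mx2 mulr0 subr0 divff. Qed.

Lemma letter_map_upper lam mu a : nonvanishing lam ->
  letter_map (upper lam mu) a =
  mx2 (torus_char (abel_letter a) lam) ((-1) ^+ a.2 * (mu a.1 / lam a.1))
      0 (torus_char (- abel_letter a) lam).
Proof.
move=> nz; rewrite /letter_map /abel_letter.
case: a.2; rewrite ?opprK !torus_charN !torus_char_unit_vec ?mul1r //.
apply: mulmx1_invr; rewrite mx2M mx2_1.
by have nz_i := nz a.1; congr mx2; field.
Qed.

(* Weighting an edge by the square of the character at its initial vertex makes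
   the contribution of a letter depend only on the edge it crosses, up to sign. *)
Definition crossing_sum lam mu L : K :=
  \sum_(t <- L) (-1) ^+ t.2 * mu t.1.2 * torus_char (t.1.1 *+ 2) lam.

Lemma word_map_upper lam mu v w : nonvanishing lam ->
  word_map w (upper lam mu) =
  mx2 (torus_char (abel w) lam)
      (crossing_sum lam mu (path_edges v w) / torus_char (v *+ 2 + abel w) lam)
      0 (torus_char (- abel w) lam).
Proof.
move=> nz; elim: w v => [|a w IH] v.
  rewrite word_map_nil abel_nil oppr0 torus_char0 /crossing_sum big_nil mul0r.
  exact: mx2_1.
rewrite word_map_cons letter_map_upper // (IH (v + abel_letter a)) mx2M abel_cons.
rewrite /crossing_sum /= big_cons /= -/(crossing_sum _ _ _) /crossed_edge.
move: (crossing_sum _ _ _) => S.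
have nz_w := torus_char_neq0 (abel w) nz; have nz_v := torus_char_neq0 v nz.
case: a => i b; have nz_i := nz i; rewrite /abel_letter /=.
by case: b; rewrite /= !(mulr2n, torus_charD, torus_charN) ?torus_char_unit_vec //;
  congr mx2; field; rewrite ?(nz_i, nz_v, nz_w, oner_neq0).
Qed.

Lemma balanced_of_crossing_sum L :
    [pchar K] =i pred0 ->
    (forall lam mu, nonvanishing lam -> crossing_sum lam mu L = 0) ->
  balanced L.
Proof.
move=> pchar0 rel [v i]; apply: (pchar0_natr_inj pchar0); apply/eqP.
rewrite -subr_eq0 -sum_signs; apply/eqP.
have := torus_char_free pchar0 (f := fun t => t.1.1 *+ 2)
  (fun lam nz => rel lam (fun j => (j == i)%:R) nz) (v *+ 2).
rewrite big_mkcond => sum_v; rewrite -[RHS]sum_v [LHS]big_mkcond.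
apply: eq_bigr => -[[u j] b] _ /=.
rewrite eq_lattice_mulr2 xpair_eqE.
by case: (u == v); case: (j == i); rewrite ?mulr1 ?mulr0.
Qed.

Lemma word_image_transvection w :
    [pchar K] =i pred0 -> reduced w -> F1 w -> ~ F2 w ->
  exists2 o : K, o != 0 & word_image w (mx2 1 o 0 1).
Proof.
move=> pchar0 red_w /abel_derived abw nF2.
apply: NNPP => no_transvection; apply: nF2; apply: F2_balanced => //.
apply: (balanced_of_crossing_sum pchar0) => lam mu nz.
apply/eqP/negP => /negP sum_neq0; apply: no_transvection.
exists (crossing_sum lam mu (path_edges 0 w)) => //.
exists (upper lam mu) => [i|]; first exact: SL2_upper.
by rewrite (word_map_upper mu 0) // abw mul0rn addr0 oppr0 torus_char0 divr1.
Qed.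

Lemma word_image_trace2 w (g : 'M[K]_2) :
    [pchar K] =i pred0 -> reduced w -> F1 w -> ~ F2 w ->
  SL2 g -> ~~ is_scalar_mx g -> \tr g = 2 -> word_image w g.
Proof.
move=> pchar0 red_w F1w nF2w SLg nscal_g tr_g.
have [o nz_o im_o] := word_image_transvection pchar0 red_w F1w nF2w.
apply: (word_image_eq_trace im_o) => //; last by rewrite tr_g mxtrace_mx2.
by rewrite is_scalar_mx2 (negbTE nz_o).
Qed.

End TriangularWords.

Section MatrixPencils.

Local Open Scope ring_scope.

Lemma coef_prod_pencil (R : nzRingType) k (s : seq (R * R)) j :
    (0 < k)%N -> (size s * k <= j)%N ->
  (\prod_(p <- s) (p.1%:P + p.2%:P * 'X^k))`_j =
  if j == (size s * k)%N then \prod_(p <- s) p.2 else 0.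
Proof.
move=> k_gt0; elim: s j => [|[A B] s IH] j.
  by move=> _; rewrite !big_nil coef1 mul0n; case: eqP.
rewrite /= mulSn => le_j; rewrite !big_cons mulrDl -mulrA coefD !coefCM coefXnM.
have le_kj : (k <= j)%N by apply: leq_trans le_j; rewrite leq_addr.
rewrite ltnNge le_kj /= !IH; [|lia|lia].
have -> : (j == size s * k)%N = false by lia.
have -> : (j - k == size s * k)%N = (j == k + size s * k)%N by lia.
by rewrite mulr0 add0r; case: ifP => _ //; rewrite mulr0.
Qed.

Variables (K : fieldType) (m : nat).
Local Notation mx := 'M[K]_m.+1.

Lemma horner_map_mxtrace (P : {poly mx}) z :
  (map_poly mxtrace P).[z] = \tr P.[z%:M].
Proof.
rewrite horner_poly horner_coef raddf_sum; apply: eq_bigr => i _ /=.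
have -> : z%:M ^+ i = (z ^+ i)%:M :> mx by rewrite rmorphXn.
by rewrite -mulmxE mul_mx_scalar mxtraceZ mulrC.
Qed.

Lemma horner_prod_scalar_mx (I : Type) (s : seq I) (F : I -> {poly mx}) z :
  (\prod_(i <- s) F i).[z%:M] = \prod_(i <- s) (F i).[z%:M].
Proof.
elim: s => [|i s IH]; first by rewrite !big_nil hornerC.
by rewrite !big_cons hornerM_comm ?IH // /comm_poly -mulmxE scalar_mxC.
Qed.

Lemma horner_mxtrace_pencil (s : seq (mx * mx)) k z :
  (map_poly mxtrace (\prod_(p <- s) (p.1%:P + p.2%:P * 'X^k))).[z] =
  \tr (\prod_(p <- s) (p.1 + z ^+ k *: p.2)).
Proof.
rewrite horner_map_mxtrace horner_prod_scalar_mx; congr (\tr _).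
apply: eq_bigr => p _; rewrite hornerD hornerCM !hornerC hornerXn.
by rewrite -rmorphXn -mulmxE mul_mx_scalar.
Qed.

Lemma prod_pencil_laurent (s : seq (mx * mx)) z : z != 0 ->
  \prod_(p <- s) (p.1 + z ^+ 2 *: p.2) =
  z ^+ size s *: \prod_(p <- s) (z^-1 *: p.1 + z *: p.2).
Proof.
move=> nz; have -> : z ^+ size s = \prod_(p <- s) z.
  by rewrite big_const_seq count_predT iter_mulr_1.
rewrite -scaler_prod; apply: eq_bigr => p _.
by rewrite scalerDr !scalerA divff // scale1r.
Qed.

End MatrixPencils.

Section LetterDilations.

Local Open Scope ring_scope.

Variables (K : fieldType) (n : nat) (pt : letter n -> K).
Hypothesis pt_inj : injective pt.
Implicit Types (a b : letter n) (w : fword n) (z : K).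

Lemma pt_linv a : pt a != pt (linv a).
Proof. by rewrite (inj_eq pt_inj) eq_sym linv_neq. Qed.

Definition letter_proj a : 'M[K]_2 := line_proj (pt a) (pt (linv a)).

Lemma prod_letter_proj a w : reduced (a :: w) ->
  exists2 c, c != 0 &
    \prod_(b <- a :: w) letter_proj b = c *: rank1 (pt a) (pt (linv (last a w))).
Proof.
elim: w a => [|b w IH] a.
  exists (pt a - pt (linv a))^-1; last exact: big_seq1.
  by rewrite invr_eq0 subr_eq0 pt_linv.
move=> /andP[neq_ba /IH[c nz_c prodE]].
exists ((pt a - pt (linv a))^-1 * c * (pt b - pt (linv a))).
  by rewrite !mulf_neq0 ?invr_eq0 // subr_eq0 ?pt_linv // (inj_eq pt_inj).
rewrite big_cons prodE -scalerAr -scalerAl rank1M !scalerA.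
by congr (_ *: _); ring.
Qed.

Lemma mxtrace_prod_letter_proj a w : reduced (a :: w) -> last a w != linv a ->
  \tr (\prod_(b <- a :: w) letter_proj b) != 0.
Proof.
move=> /prod_letter_proj[c nz_c ->] neq_last.
rewrite mxtraceZ mxtrace_rank1 mulf_neq0 // subr_eq0 (inj_eq pt_inj).
by rewrite eq_sym (inv_eq (@linvK n)).
Qed.

Definition dilation_assignment z (i : 'I_n) : 'M[K]_2 :=
  dilation z (pt (i, false)) (pt (i, true)).

Lemma SL2_dilation_assignment z i : z != 0 -> SL2 (dilation_assignment z i).
Proof. by move=> nz; apply: det_dilation => //; apply: (pt_linv (i, false)). Qed.

Lemma word_map_dilation_assignment z w : z != 0 ->
  word_map w (dilation_assignment z) =
  \prod_(a <- w) dilation z (pt a) (pt (linv a)).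
Proof.
move=> nz; apply: eq_bigr => -[i []] _ //=.
by rewrite /dilation_assignment dilationV //; apply: (pt_linv (i, false)).
Qed.

End LetterDilations.

Section TraceSurjectivity.

Local Open Scope ring_scope.

Variable K : closedFieldType.

(* Multiplying by z ^+ size s turns the trace into a polynomial in z; its constant
   and top coefficients are the traces of the two products. *)
Lemma mxtrace_laurent_prod_surj m (s : seq ('M[K]_m.+1 * 'M[K]_m.+1)) (t : K) :
    s != [::] ->
    \tr (\prod_(p <- s) p.1) != 0 -> \tr (\prod_(p <- s) p.2) != 0 ->
  exists2 z, z != 0 & \tr (\prod_(p <- s) (z^-1 *: p.1 + z *: p.2)) = t.
Proof.
move=> s_neq0 tr1 tr2; have L_gt0 : (0 < size s)%N by rewrite lt0n size_eq0.
pose q := map_poly mxtrace (\prod_(p <- s) (p.1%:P + p.2%:P * 'X^2)) -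
          t *: 'X^(size s).
have qE z : q.[z] =
    \tr (\prod_(p <- s) (p.1 + z ^+ 2 *: p.2)) - t * z ^+ size s.
  by rewrite hornerD horner_mxtrace_pencil hornerN hornerZ hornerXn.
have q_top : q`_(size s * 2) != 0.
  rewrite coefB coefZ coefXn coef_map coef_prod_pencil // eqxx.
  have -> : (size s * 2 == size s)%N = false by lia.
  by rewrite mulr0 subr0.
have q_0 : q.[0] != 0.
  rewrite qE [0 ^+ size s]expr0n gtn_eqF // mulr0 subr0.
  by under eq_bigr do rewrite expr0n scale0r addr0.
have /closed_rootP[z /rootP qz] : size q != 1.
  by apply: contraNneq q_top => sz_q; rewrite nth_default // sz_q; lia.
have nz : z != 0 by apply: contraNneq q_0 => z0; move: qz; rewrite z0 => ->.
exists z => //; apply: (mulfI (expf_neq0 (size s) nz)).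
rewrite -mxtraceZ -prod_pencil_laurent // [RHS]mulrC.
by apply/eqP; rewrite -subr_eq0 -qE qz.
Qed.

Variables (n : nat) (pt : letter n -> K).
Hypothesis pt_inj : injective pt.
Implicit Types (a : letter n) (w : fword n) (t : K).

Lemma cyclically_reduced_trace_surj a w t :
    reduced (a :: w) -> last a w != linv a ->
  exists2 h, word_image (a :: w) h & \tr h = t.
Proof.
move=> red_w neq_last.
pose pencil b : 'M[K]_2 * 'M[K]_2 := (letter_proj pt (linv b), letter_proj pt b).
have [|||z nz tr_z] := mxtrace_laurent_prod_surj (s := map pencil (a :: w)) t.
- by [].
- have red_linv : reduced (map (@linv n) (a :: w)) by rewrite reduced_map_linv.
  have := mxtrace_prod_letter_proj (K := K) pt_inj red_linv.
  by rewrite last_map (inj_eq (@linv_inj n)) -map_cons !big_map; apply.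
- by rewrite big_map; apply: mxtrace_prod_letter_proj.
exists (word_map (a :: w) (dilation_assignment pt z)).
  by exists (dilation_assignment pt z) => // i; apply: SL2_dilation_assignment.
rewrite word_map_dilation_assignment // -tr_z big_map; congr (\tr _).
by apply: eq_bigr => b _; rewrite /= /letter_proj linvK addrC.
Qed.

Lemma word_image_trace_surj w t : reduced w -> w != [::] ->
  exists2 h, word_image w h & \tr h = t.
Proof.
have [m] := ubnP (size w); elim: m w => // m IH [|a w] // sz_w red_w _.
have [|neq_last] := eqVneq (last a w) (linv a); last first.
  exact: cyclically_reduced_trace_surj.
case/lastP: w sz_w red_w => [|w b].
  by move=> _ _ /eqP; rewrite eq_sym (negbTE (linv_neq a)).
rewrite last_rcons => + + eq_b; rewrite {b}eq_b => sz_w red_w.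
have [||| h [x SLx <-] tr_x] := IH w.
- by move: sz_w; rewrite /= size_rcons; lia.
- by move: red_w; rewrite !reducedE /= rcons_path => /andP[/path_sorted].
- by apply: contraTneq red_w => ->; rewrite /= eqxx.
exists (word_map (a :: rcons w (linv a)) x); first by exists x.
rewrite word_map_cons word_map_rcons [LHS]mxtrace_mulC -mulmxA.
by rewrite mulmxE letter_map_linv // mulr1.
Qed.

End TraceSurjectivity.

Definition letter_code (R : pzSemiRingType) n (a : letter n) : R :=
  (a.1.*2 + a.2)%:R%R.

Lemma letter_code_inj (R : idomainType) n :
  [pchar R]%R =i pred0 -> injective (@letter_code R n).
Proof.
move=> pchar0 [i b] [j c] /(pchar0_natr_inj pchar0) /= eq_ij.
by congr (_, _); [apply: val_inj => /=|]; move: eq_ij; case: b; case: c => /=; lia.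
Qed.

(* PSL(2,K) = SL(2,K)/{+-1}: surjectivity of the induced word map means every
   g in SL(2,K) equals w(x) up to sign for some x in SL(2,K)^n. *)
Theorem theorem1p3 (n : nat) (hn : (2 <= n)%N)
  (K : closedFieldType) (hK : ([pchar K]%R =i pred0))
  (w : fword n) (hw : reduced w) (h1 : F1 w) (h2 : ~ F2 w) :
  forall g : 'M[K]_2, SL2 g ->
    exists x : 'I_n -> 'M[K]_2,
      (forall i, SL2 (x i)) /\
      (word_map w x = g \/ word_map w x = (- g)%R).
Proof.
move=> g SLg.
suff [[x SLx wx]|[x SLx wx]] : word_image w g \/ word_image w (- g)%R.
- by exists x; split=> //; left.
- by exists x; split=> //; right.
have [/(SL2_scalar SLg)[->|->]|nscal_g] := boolP (is_scalar_mx g).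
- by left; apply: word_image1.
- by right; rewrite opprK; apply: word_image1.
have [tr_g|tr_g] := eqVneq (\tr g)%R 2%R.
  by left; apply: word_image_trace2.
have [tr_Ng|tr_Ng] := eqVneq (\tr g)%R (- 2)%R.
  right; apply: word_image_trace2; rewrite ?is_scalar_mxN //; first exact: SL2N.
  by rewrite raddfN /= tr_Ng opprK.
have w_neq : w != [::].
  by apply/eqP => w_nil; apply: h2; rewrite w_nil; apply: der_one.
have [h im_h tr_h] :=
  word_image_trace_surj (letter_code_inj hK) (\tr g)%R hw w_neq.
left; apply: (word_image_eq_trace im_h) => //.
by apply: SL2_nonscalar (SL2_word_image im_h) _ _; rewrite tr_h.
Qed.
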